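(* Let $\underline{A},\overline{A}\in\mathbb{R}^{n\times n}$ with $\underline{A}\le\overline{A}$ (entrywise) and let $\mathbf{A}=\{A\in\mathbb{R}^{n\times n} : \underline{A}\le A\le\overline{A}\}$. Then $\mathbf{A}$ is strongly an $R_0$-matrix if and only if for each index set $\emptyset\ne I\subseteq\{1,\dots,n\}$, with $J:=\{1,\dots,n\}\setminus I$, the system $$\underline{A}_{I,I}x\le0,\quad \overline{A}_{I,I}x\ge0,\quad \overline{A}_{J,I}x\ge0,\quad x>0$$ is infeasible.
   Context: All inequalities between vectors or matrices are entrywise. A matrix property holds strongly for an interval matrix $\mathbf{A}$ if it holds for every $A\in\mathbf{A}$. For index sets $I,J$, $A_{I,J}$ is the submatrix of $A$ with rows indexed by $I$ and columns indexed by $J$. A matrix $A\in\mathbb{R}^{n\times n}$ is an $R_0$-matrix if the linear complementarity problem $y=Az$, $y,z\ge0$, $y^Tz=0$ has only the solution $z=0$; equivalently, if for each $\emptyset\ne I\subseteq\{1,\dots,n\}$, with $J:=\{1,\dots,n\}\setminus I$, the system $A_{I,I}x=0$, $A_{J,I}x\ge0$, $x>0$ is infeasible. *)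

(* Defs.v *)
From mathcomp Require Import all_boot all_order all_algebra.

Set Implicit Arguments.
Unset Strict Implicit.
Unset Printing Implicit Defensive.

Import Order.TTheory GRing.Theory Num.Theory.
Local Open Scope ring_scope.

(* The scalars range over an arbitrary ordered field; the real numbers are the
   intended instance. *)

Definition mxle (R : realFieldType) (m n : nat) (A B : 'M[R]_(m, n)) : Prop :=
  forall i j, A i j <= B i j.

Definition mxlt (R : realFieldType) (m n : nat) (A B : 'M[R]_(m, n)) : Prop :=
  forall i j, A i j < B i j.

Definition interval_mx (R : realFieldType) (m n : nat)
    (Al Au A : 'M[R]_(m, n)) : Prop :=
  mxle Al A /\ mxle A Au.

Definition strongly (R : realFieldType) (n : nat) (P : 'M[R]_n -> Prop)
    (bA : 'M[R]_n -> Prop) : Prop :=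
  forall A, bA A -> P A.

(* The submatrix A_{I,J}; rows and columns keep their original order, since
   enum_val lists the elements of an index set increasingly. *)
Definition submx_set (R : realFieldType) (m n : nat) (A : 'M[R]_(m, n))
    (I : {set 'I_m}) (J : {set 'I_n}) : 'M[R]_(#|I|, #|J|) :=
  mxsub (fun i : 'I_#|I| => enum_val i) (fun j : 'I_#|J| => enum_val j) A.

Definition R0_matrix (R : realFieldType) (n : nat) (A : 'M[R]_n) : Prop :=
  forall y z : 'cV[R]_n,
    y = A *m z -> mxle 0 y -> mxle 0 z -> y^T *m z = 0 -> z = 0.

(* Main.v *)
Require Import Defs.
From mathcomp Require Import all_boot all_order all_algebra.
Import Order.TTheory GRing.Theory Num.Theory.
Set Implicit Arguments.
Unset Strict Implicit.

Local Open Scope ring_scope.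

(** If [z >= 0] is supported exactly on [I] and [x > 0] is its restriction to
    [I], then [A_{K,I} x] is the restriction of [A z] to [K].  A nonzero
    solution [z] of the complementarity problem for some [A] in the interval
    has [A z = 0] on its support, and bounding [A] by its end points gives the
    system.  Conversely, for a solution [x] of the system, zero lies between
    the [i]-th entries of [Al z] and [Au z] for [i] in [I], so a convex
    combination of the [i]-th rows of [Al] and [Au] annihilates [z]; taking
    the rows of [Au] outside [I] gives a matrix that is not [R_0]. *)

Lemma submx_set_mul (R : realFieldType) (m n : nat) (A : 'M[R]_(m, n))
    (K : {set 'I_m}) (I : {set 'I_n}) (z : 'cV[R]_n) :
  (forall j, j \notin I -> z j 0 = 0) ->
  submx_set A K I *m rowsub (fun k : 'I_#|I| => enum_val k) z
  = rowsub (fun k : 'I_#|K| => enum_val k) (A *m z).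
Proof.
move=> zI; apply/matrixP=> k c; rewrite ord1 !mxE.
rewrite [RHS](bigID (mem I)) /= [X in _ + X]big1 ?addr0 => [|j /zI ->];
  last by rewrite mulr0.
by rewrite [RHS]big_enum_val; apply: eq_bigr => j _; rewrite !mxE.
Qed.

Lemma mxle_mul2r (R : realFieldType) (m n p : nat) (A B : 'M[R]_(m, n))
    (C : 'M[R]_(n, p)) :
  mxle A B -> mxle 0 C -> mxle (A *m C) (B *m C).
Proof.
move=> AB C0 i k; rewrite !mxE; apply: ler_sum => j _.
by apply: ler_wpM2r; [move: (C0 j k); rewrite mxE | exact: AB].
Qed.

Lemma extend_col_by0 (R : realFieldType) (n : nat) (I : {set 'I_n})
    (x : 'cV[R]_#|I|) :
  exists2 z : 'cV[R]_n, forall j, j \notin I -> z j 0 = 0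
    & rowsub (fun k : 'I_#|I| => enum_val k) z = x.
Proof.
(* The sum has at most one term, as [enum_val] is injective, and is empty for [i] outside [I]; no
   inverse of [enum_val] is needed. *)
exists (\col_i \sum_(k < #|I| | enum_val k == i) x k 0) => [j jI|].
  rewrite mxE big1 // => k /eqP kj.
  by case/negP: jI; rewrite -kj enum_valP.
apply/matrixP=> k c; rewrite ord1 !mxE (big_pred1 k) // => l /=.
by rewrite (inj_eq enum_val_inj).
Qed.

(** A sum of nonnegative terms vanishes only if every term does. *)
Lemma complementary_entry0 (R : realFieldType) (n : nat) (y z : 'cV[R]_n) :
  mxle 0 y -> mxle 0 z -> y^T *m z = 0 -> forall i, y i 0 * z i 0 = 0.
Proof.
move=> y0 z0 /matrixP /(_ 0 0); rewrite !mxE => yz i.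
have yz_ge0 j : true -> 0 <= y^T 0 j * z j 0.
  move=> _; rewrite mxE; move: (y0 j 0) (z0 j 0); rewrite !mxE.
  exact: mulr_ge0.
by have /allP/(_ i) := etrans (esym (psumr_eq0 _ yz_ge0)) (introT eqP yz);
  rewrite mem_index_enum !mxE => /(_ isT) /eqP.
Qed.

Lemma convex_weight_zero (R : realFieldType) (l u : R) :
  l <= 0 -> 0 <= u -> exists t, [/\ 0 <= t, t <= 1 & l + t * (u - l) = 0].
Proof.
move=> l0 u0; have lu : 0 <= u - l by rewrite subr_ge0 (le_trans l0).
(* If [u = l], both signs force [l = 0] and any weight works. Otherwise solving for [t] gives
   [- l / (u - l)], which is at most 1 because [0 <= u]. *)
have [ul|nul] := eqVneq (u - l) 0.
  exists 0; rewrite lexx ler01 mul0r addr0; split=> //.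
  by apply: le_anti; rewrite l0 -(subr0_eq ul).
exists (- l / (u - l)); rewrite divfK // subrr; split=> //.
  by rewrite divr_ge0 ?oppr_ge0.
by rewrite ler_pdivrMr ?lt_def ?nul // mul1r lerDr.
Qed.

Lemma interval_mx_row_zero (R : realFieldType) (m n : nat)
    (Al Au : 'M[R]_(m, n)) (I : {set 'I_m}) (z : 'cV[R]_n) :
  mxle Al Au ->
  (forall i, i \in I -> (Al *m z) i 0 <= 0 <= (Au *m z) i 0) ->
  exists A, [/\ interval_mx Al Au A,
    forall i, i \in I -> (A *m z) i 0 = 0
    & forall i, i \notin I -> (A *m z) i 0 = (Au *m z) i 0].
Proof.
move=> hA hI.
(* One weight serves a whole row, so the [i]-th entry of the product with [z] is interpolated by the
   same [t]; weight 1 selects the row of [Au]. *)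
have ex_t i : exists t : R, [/\ 0 <= t, t <= 1 &
    if i \in I
    then (Al *m z) i 0 + t * ((Au *m z) i 0 - (Al *m z) i 0) == 0
    else t == 1].
  have [/hI /andP[l0 u0]|_] := boolP (i \in I); last first.
    by exists 1; rewrite ler01 lexx eqxx.
  by have [t [t0 t1 /eqP]] := convex_weight_zero l0 u0; exists t.
have [t ht] := fin_all_exists ex_t.
pose A := \matrix_(i, j) (Al i j + t i * (Au i j - Al i j)).
have Az i : (A *m z) i 0
    = (Al *m z) i 0 + t i * ((Au *m z) i 0 - (Al *m z) i 0).
  rewrite !mxE -sumrB mulr_sumr -big_split /=; apply: eq_bigr => j _.
  by rewrite mxE mulrDl -mulrA mulrBl.
exists A; split.
- split=> i j; rewrite mxE; have [t0 t1 _] := ht i;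
    have d0 : 0 <= Au i j - Al i j by rewrite subr_ge0; exact: hA.
    by rewrite lerDl mulr_ge0.
  by rewrite -lerBrDl ler_piMl.
- by move=> i iI; rewrite Az; have [_ _] := ht i; rewrite iI => /eqP.
- move=> i iI; rewrite Az; have [_ _] := ht i.
  by rewrite (negbTE iI) => /eqP ->; rewrite mul1r addrC subrK.
Qed.

Theorem proposition14 (R : realFieldType) (n : nat) (Al Au : 'M[R]_n)
    (hA : mxle Al Au) :
  strongly (@R0_matrix R n) (interval_mx Al Au) <->
  (forall I : {set 'I_n}, I != set0 ->
     let J := [set: 'I_n] :\: I in
     ~ exists x : 'cV[R]_#|I|,
         [/\ mxle (submx_set Al I I *m x) 0,
             mxle 0 (submx_set Au I I *m x),
             mxle 0 (submx_set Au J I *m x)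
           & mxlt 0 x]).
Proof.
split.
  move=> hR0 I /set0Pn[i0 i0I] J [x [hl hu hJ x0]].
  have [z zI zx] := extend_col_by0 x; rewrite -{}zx in hl hu hJ x0.
  rewrite !submx_set_mul // in hl hu hJ.
  have zpos i : i \in I -> 0 < z i 0.
    by move=> iI; have := x0 (enum_rank_in iI i) 0; rewrite !mxE enum_rankK_in.
  have z_ge0 : mxle 0 z.
    move=> i c; rewrite ord1 mxE.
    by have [/zpos/ltW|/zI ->] := boolP (i \in I).
  have hI i : i \in I -> (Al *m z) i 0 <= 0 <= (Au *m z) i 0.
    move=> iI; have := hl (enum_rank_in iI i) 0.
    have := hu (enum_rank_in iI i) 0.
    rewrite [leLHS]mxE [leRHS]mxE enum_rankK_in // => ->.
    by rewrite [leLHS]mxE [leRHS]mxE enum_rankK_in // => ->.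
  have [A [hAI AI AJ]] := interval_mx_row_zero hA hI.
  have Az_ge0 : mxle 0 (A *m z).
    move=> i c; rewrite ord1 [leLHS]mxE.
    have [/AI -> //|iI] := boolP (i \in I); rewrite AJ //.
    have iJ : i \in J by rewrite !inE iI.
    have := hJ (enum_rank_in iJ i) 0.
    by rewrite [leLHS]mxE [leRHS]mxE enum_rankK_in.
  (* Complementarity holds termwise: [A *m z] vanishes on [I] and [z] vanishes off [I]. Then [z = 0]
     contradicts [zpos] at [i0]. *)
  have zz : z = 0.
    apply: (hR0 A hAI _ z erefl Az_ge0 z_ge0).
    apply/matrixP=> a b; rewrite !ord1 [LHS]mxE [RHS]mxE big1 // => i _.
    rewrite [_^T _ _]mxE.
    by have [/AI ->|/zI ->] := boolP (i \in I); rewrite ?mul0r ?mulr0.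
  by have := zpos _ i0I; rewrite zz mxE ltxx.
move=> hsys A [hAl hAu] y z yE y_ge0 z_ge0 yz.
apply/eqP/negP => /negP z_neq0.
pose I := [set i | z i 0 != 0].
have zI i : i \notin I -> z i 0 = 0 by rewrite inE negbK => /eqP.
have yI i : i \in I -> y i 0 = 0.
  rewrite inE => zi; have /eqP := complementary_entry0 y_ge0 z_ge0 yz i.
  by rewrite mulf_eq0 (negbTE zi) orbF => /eqP.
(* Since [z] is nonnegative, [y] lies between [Al *m z] and [Au *m z]. On the support [I] of [z],
   where [y] is zero, this gives the sign conditions on both products. *)
have Alz := mxle_mul2r hAl z_ge0; have Auz := mxle_mul2r hAu z_ge0.
rewrite -yE in Alz Auz.
have Auz_ge0 i : 0 <= (Au *m z) i 0.
  by apply: le_trans (Auz i 0); have := y_ge0 i 0; rewrite mxE.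
apply: (hsys I).
  apply: contra z_neq0 => /eqP I0; apply/eqP/matrixP => i c.
  by rewrite ord1 [RHS]mxE zI // I0 inE.
exists (rowsub (fun k : 'I_#|I| => enum_val k) z); rewrite !submx_set_mul //.
split=> k c; rewrite ord1.
- by rewrite [leLHS]mxE [leRHS]mxE -(yI _ (enum_valP k)).
- by rewrite [leLHS]mxE [leRHS]mxE.
- by rewrite [leLHS]mxE [leRHS]mxE.
- have := enum_valP k; rewrite !mxE inE lt_def => ->.
  by have := z_ge0 (enum_val k) 0; rewrite mxE.
Qed.
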